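(* Let $\mathbf{C}$ be a category together with a class $\mathcal{M}$ of morphisms in $\mathbf{C}$ and a function $w:\mathcal{M}\to[0,\infty]$. The path distance $d_w$ is a symmetric Lawvere metric on $\mathbf{C}$. If $\mathcal{M}$ includes all isomorphisms in $\mathbf{C}$ and $w(f)=0$ for each isomorphism $f$, then $d_w$ is a metric on $\mathbf{C}$.
   Context: A zigzag from $A$ to $B$ is a finite sequence of morphisms joining objects $A=A_0,A_1,\dots,A_n=B$ ($n\ge0$), the $i$-th one being a morphism between $A_{i-1}$ and $A_i$ in either direction. The cost of a zigzag whose morphisms are all in $\mathcal{M}$ is the sum of the weights $w$ of its morphisms ($0$ if $n=0$). The path distance $d_w(A,B)\in[0,\infty]$ is the infimum of the costs of all zigzags from $A$ to $B$ whose morphisms are all in $\mathcal{M}$, and is $\infty$ if there are no such zigzags. A symmetric Lawvere metric on a category is a function $d$ assigning to each pair of objects a value in $[0,\infty]$ with $d(M,M)=0$, $d(M,N)=d(N,M)$ and $d(M,Q)\le d(M,N)+d(N,Q)$ for all objects. A metric on a category is a symmetric Lawvere metric such that $d(M,N)=0$ whenever $M\cong N$. *)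

(* Defs.v *)
From HB Require Import structures.
From mathcomp Require Import all_boot all_order all_algebra.
From mathcomp Require Import boolp classical_sets reals ereal.

Set Implicit Arguments.
Unset Strict Implicit.
Unset Printing Implicit Defensive.

Import Order.TTheory GRing.Theory Num.Theory.
Local Open Scope classical_set_scope.
Local Open Scope ring_scope.
Local Open Scope ereal_scope.

Record category := Category {
  obj :> Type;
  mor : obj -> obj -> Type;
  cat_id : forall A, mor A A;
  cat_comp : forall A B D, mor B D -> mor A B -> mor A D;
  cat_compA : forall A B D E (h : mor D E) (g : mor B D) (f : mor A B),
    cat_comp h (cat_comp g f) = cat_comp (cat_comp h g) f;
  cat_comp1m : forall A B (f : mor A B), cat_comp (cat_id B) f = f;
  cat_compm1 : forall A B (f : mor A B), cat_comp f (cat_id A) = f }.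

Arguments mor {c} A B.
Arguments cat_id {c} A.

Definition is_iso (C : category) (A B : C) (f : mor A B) : Prop :=
  exists g : mor B A, cat_comp g f = cat_id A /\ cat_comp f g = cat_id B.

Definition isomorphic (C : category) (A B : C) : Prop :=
  exists f : mor A B, is_iso f.

Definition morphism_class (C : category) := forall A B : C, set (mor A B).

(* The proof argument makes a weight a function on the class M only. *)
Definition weight (R : realType) (C : category) (M : morphism_class C) :=
  forall (A B : C) (f : mor A B), M A B f -> \bar R.

Inductive zigzag (C : category) : C -> C -> Type :=
| ZNil A : zigzag A A
| ZFwd A A' B (f : mor A A') (z : zigzag A' B) : zigzag A B
| ZBwd A A' B (f : mor A' A) (z : zigzag A' B) : zigzag A B.

Fixpoint zigzag_in (C : category) (M : morphism_class C) (A B : C)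
    (z : zigzag A B) : Prop :=
  match z with
  | ZNil _ => True
  | ZFwd _ _ _ f z' => M _ _ f /\ zigzag_in M z'
  | ZBwd _ _ _ f z' => M _ _ f /\ zigzag_in M z'
  end.

Fixpoint cost (R : realType) (C : category) (M : morphism_class C)
    (w : weight R M) (A B : C) (z : zigzag A B) : zigzag_in M z -> \bar R :=
  match z return zigzag_in M z -> \bar R with
  | ZNil _ => fun _ => 0
  | ZFwd _ _ _ f z' => fun '(conj Mf Mz') => w _ _ f Mf + cost w Mz'
  | ZBwd _ _ _ f z' => fun '(conj Mf Mz') => w _ _ f Mf + cost w Mz'
  end.

(* ereal_inf set0 = +oo, which covers the case without zigzags in M. *)
Definition path_distance (R : realType) (C : category) (M : morphism_class C)
    (w : weight R M) (A B : C) : \bar R :=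
  ereal_inf [set x | exists (z : zigzag A B) (Mz : zigzag_in M z),
                       x = cost w Mz].

Record symmetric_lawvere_metric (R : realType) (C : category)
    (d : C -> C -> \bar R) : Prop := SymmetricLawvereMetric {
  lawvere_ge0 : forall A B, 0 <= d A B;
  lawvere_refl : forall A, d A A = 0;
  lawvere_sym : forall A B, d A B = d B A;
  lawvere_triangle : forall A B D, d A D <= d A B + d B D }.

Record category_metric (R : realType) (C : category)
    (d : C -> C -> \bar R) : Prop := CategoryMetric {
  metric_lawvere : symmetric_lawvere_metric d;
  metric_iso : forall A B, isomorphic A B -> d A B = 0 }.

(* Main.v *)
Require Import Defs.
From HB Require Import structures.
From mathcomp Require Import all_boot all_order all_algebra.
From mathcomp Require Import boolp classical_sets reals ereal.

Set Implicit Arguments.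
Unset Strict Implicit.
Unset Printing Implicit Defensive.

Import Order.TTheory GRing.Theory Num.Theory.
Local Open Scope classical_set_scope.
Local Open Scope ring_scope.
Local Open Scope ereal_scope.

(** Zigzags in [M] can be concatenated, which adds costs ([cost_cat]), and reversed, which preserves
    cost ([cost_rev]); the empty zigzag costs 0. Passing to infima of nonnegative costs yields the
    triangle inequality, symmetry and the vanishing of self-distances. An isomorphism of weight 0 is
    by itself a zigzag of cost 0, so isomorphic objects are at distance 0. *)

Section PathDistance.
Context (R : realType) (C : category) (M : morphism_class C) (w : weight R M).
Hypothesis w_ge0 : forall (A B : C) (f : mor A B) (Mf : @M A B f),
  0 <= @w A B f Mf.

Lemma cost_ge0 (A B : C) (z : zigzag A B) (Mz : zigzag_in M z) :
  0 <= cost w Mz.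
Proof.
elim: z Mz => [A0|A0 A' B0 f z IH|A0 A' B0 f z IH] //=;
  by case=> Mf Mz; rewrite adde_ge0.
Qed.

(** The witness is the concatenation of [z1] and [z2]. Because [cost] takes the membership proof as
    an argument, the zigzag and its proof are built together by induction on [z1]. *)
Lemma cost_cat (A B D : C) (z1 : zigzag A B) (z2 : zigzag B D)
    (Mz1 : zigzag_in M z1) (Mz2 : zigzag_in M z2) :
  exists (z : zigzag A D) (Mz : zigzag_in M z),
    cost w Mz = cost w Mz1 + cost w Mz2.
Proof.
elim: z1 z2 Mz1 Mz2 => [A0|A0 A' B0 f z1 IH|A0 A' B0 f z1 IH] z2 /=.
- by move=> _ Mz2; exists z2, Mz2; rewrite add0e.
- case=> Mf Mz1 Mz2; have [z [Mz Ez]] := IH z2 Mz1 Mz2.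
  by exists (ZFwd f z), (conj Mf Mz); rewrite /= Ez addeA.
- case=> Mf Mz1 Mz2; have [z [Mz Ez]] := IH z2 Mz1 Mz2.
  by exists (ZBwd f z), (conj Mf Mz); rewrite /= Ez addeA.
Qed.

Lemma cost_rev (A B : C) (z : zigzag A B) (Mz : zigzag_in M z) :
  exists (z' : zigzag B A) (Mz' : zigzag_in M z'), cost w Mz' = cost w Mz.
Proof.
elim: z Mz => [A0|A0 A' B0 f z IH|A0 A' B0 f z IH] /=.
- by case; exists (ZNil A0), I.
- case=> Mf Mz; have [z' [Mz' <-]] := IH Mz.
  (* The first step [f] becomes the last one, traversed in the opposite direction; it keeps the
     membership proof [Mf], hence its weight. *)
  have [z'' [Mz'' E]] :=
    cost_cat Mz' (conj Mf I : zigzag_in M (ZBwd f (ZNil A0))).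
  by exists z'', Mz''; rewrite E /= adde0 addeC.
- case=> Mf Mz; have [z' [Mz' <-]] := IH Mz.
  have [z'' [Mz'' E]] :=
    cost_cat Mz' (conj Mf I : zigzag_in M (ZFwd f (ZNil A0))).
  by exists z'', Mz''; rewrite E /= adde0 addeC.
Qed.

Lemma path_distance_le_cost (A B : C) (z : zigzag A B) (Mz : zigzag_in M z) :
  path_distance w A B <= cost w Mz.
Proof. by apply: ereal_inf_lbound; exists z, Mz. Qed.

Lemma path_distance_ge0 (A B : C) : 0 <= path_distance w A B.
Proof. by apply: le_ereal_inf_tmp => _ [z [Mz ->]]; exact: cost_ge0. Qed.

Lemma path_distance_refl (A : C) : path_distance w A A = 0.
Proof.
apply/eqP; rewrite eq_le path_distance_ge0 andbT.
exact: (path_distance_le_cost (I : zigzag_in M (ZNil A))).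
Qed.

(** Each zigzag from [B] to [A] reverses to a competitor of equal cost from [A] to [B]. As [A] and
    [B] are arbitrary, this one inequality gives symmetry. *)
Lemma path_distance_le_sym (A B : C) :
  path_distance w A B <= path_distance w B A.
Proof.
apply: le_ereal_inf_tmp => _ [z [Mz ->]].
by have [z' [Mz' <-]] := cost_rev Mz; exact: path_distance_le_cost.
Qed.

Lemma path_distance_triangle (A B D : C) :
  path_distance w A D <= path_distance w A B + path_distance w B D.
Proof.
have dNy X Y : path_distance w X Y != -oo.
  by rewrite gt_eqF// (lt_le_trans _ (path_distance_ge0 X Y)) ?ltNy0.
(* An infinite summand makes the right-hand side [+oo], since the other one is not [-oo]. Otherwise
   both infima are finite, so zigzags within [e / 2] of each exist, and their concatenation is
   within [e] of the sum. *)
have [AB|AB] := eqVneq (path_distance w A B) +oo.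
  by rewrite AB addye ?leey.
have [BD|BD] := eqVneq (path_distance w B D) +oo.
  by rewrite BD addey ?leey.
have fAB : path_distance w A B \is a fin_num by rewrite fin_numE dNy.
have fBD : path_distance w B D \is a fin_num by rewrite fin_numE dNy.
apply/lee_addgt0Pr => e e0.
have e20 : (0 < e / 2)%R by rewrite divr_gt0.
have [_ [z1 [Mz1 ->]] /ltW lt1] := lb_ereal_inf_adherent e20 fAB.
have [_ [z2 [Mz2 ->]] /ltW lt2] := lb_ereal_inf_adherent e20 fBD.
have [z [Mz Ez]] := cost_cat Mz1 Mz2.
apply: le_trans (path_distance_le_cost Mz) _.
by rewrite Ez (splitr e) EFinD addeACA leeD.
Qed.

Lemma path_distance_symmetric_lawvere :
  symmetric_lawvere_metric (path_distance w).
Proof.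
split.
- exact: path_distance_ge0.
- exact: path_distance_refl.
- by move=> A B; apply/eqP; rewrite eq_le !path_distance_le_sym.
- exact: path_distance_triangle.
Qed.

End PathDistance.

Theorem lemma3p5 (R : realType) (C : category) (M : morphism_class C)
    (w : weight R M)
    (w_ge0 : forall (A B : C) (f : mor A B) (Mf : M A B f), 0 <= w A B f Mf) :
  symmetric_lawvere_metric (path_distance w) /\
  ((forall (A B : C) (f : mor A B), is_iso f -> M A B f) ->
   (forall (A B : C) (f : mor A B) (Mf : M A B f), is_iso f -> w A B f Mf = 0) ->
   category_metric (path_distance w)).
Proof.
have dL := path_distance_symmetric_lawvere w_ge0.
split=> // Miso wiso; split=> // A B [f fiso].
apply/eqP; rewrite eq_le path_distance_ge0// andbT.
(* The competitor is the zigzag with the single step [f], whose cost is the weight of [f] plus 0. *)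
apply: le_trans (path_distance_le_cost w
  (conj (Miso _ _ f fiso) I : zigzag_in M (ZFwd f (ZNil B)))) _.
by rewrite /= wiso// adde0.
Qed.
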